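(* Let $\beta>\alpha\ge\frac32$. For $z\in\mathbb{H}$ let $\Lambda_z=\frac{1}{\sqrt{\operatorname{Im}(z)}}\big(\mathbb{Z}\oplus z\mathbb{Z}\big)$ and $$E(\Lambda_z)=\sum_{\mathbb{P}\in\Lambda_z}|\mathbb{P}|^2\Big(e^{-\pi\alpha|\mathbb{P}|^2}-e^{-\pi\beta|\mathbb{P}|^2}\Big).$$ Then among two-dimensional lattices of unit density (i.e. among the lattices $\Lambda_z$, $z\in\mathbb{H}$) a minimizer of $E$ exists, and the minimum is achieved at the hexagonal lattice, i.e. at $z=e^{i\pi/3}$: $E(\Lambda_z)\ge E(\Lambda_{e^{i\pi/3}})$ for all $z\in\mathbb{H}$.
   Context: $\mathbb{H}=\{z\in\mathbb{C}:\operatorname{Im}(z)>0\}$. Up to rotation, every two-dimensional lattice of unit density (covolume $1$) is of the form $\Lambda_z=\frac{1}{\sqrt{\operatorname{Im}(z)}}(\mathbb{Z}\oplus z\mathbb{Z})\subset\mathbb{C}\cong\mathbb{R}^2$ with $z\in\mathbb{H}$. The hexagonal lattice is the one corresponding to $z=e^{i\pi/3}$. *)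

(* Defs.v *)
From mathcomp Require Import all_boot all_order all_algebra.
From mathcomp Require Import all_classical all_reals all_analysis.
From mathcomp Require Import complex.

Set Implicit Arguments.
Unset Strict Implicit.
Unset Printing Implicit Defensive.

Import Order.TTheory GRing.Theory Num.Theory.

Local Open Scope classical_set_scope.
Local Open Scope complex_scope.
Local Open Scope ring_scope.

Definition upper_half_plane (R : realType) : set R[i] :=
  [set z | 0 < complex.Im z].
Arguments upper_half_plane R : clear implicits.

Definition unit_lattice (R : realType) (z : R[i]) : set R[i] :=
  [set P | exists m n : int,
    P = ((Num.sqrt (complex.Im z))^-1)%:C * (m%:~R + n%:~R * z)].

Definition unit_lattices (R : realType) : set (set R[i]) :=
  [set unit_lattice z | z in upper_half_plane R].
Arguments unit_lattices R : clear implicits.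

Definition expi (R : realType) (t : R) : R[i] := cos t +i* sin t.

Definition hexagonal_lattice (R : realType) : set R[i] :=
  unit_lattice (expi (pi / 3)).
Arguments hexagonal_lattice R : clear implicits.

(* The sum is unordered over the points of L.  It is taken in the extended
   reals: for alpha <= beta the terms are nonnegative, so esum, which is the
   supremum of the finite partial sums, is the value of the series. *)
Definition energy (R : realType) (alpha beta : R) (L : set R[i]) : \bar R :=
  \esum_(P in L)
    (Normc.normc P ^+ 2 * (expR (- pi * alpha * Normc.normc P ^+ 2)
                     - expR (- pi * beta * Normc.normc P ^+ 2)))%:E.

(* Main.v *)
Require Import Defs.
From mathcomp Require Import all_boot all_order all_algebra.
From mathcomp Require Import all_classical all_reals all_analysis.
From mathcomp Require Import complex.
From mathcomp Require Import ring lra zify.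

Set Implicit Arguments.
Unset Strict Implicit.
Unset Printing Implicit Defensive.

Import Order.TTheory GRing.Theory Num.Theory.
Import numFieldNormedType.Exports.

Local Open Scope classical_set_scope.
Local Open Scope ring_scope.

(** Write the energy as an integral over the rate s in [alpha, beta] of
    sums of r^2 e^(- pi s r), r = |P|^2: the theorem follows if, for every
    s >= 3/2, the sum of r^2 e^(- pi s r) over a unit lattice is smallest for the
    hexagonal one.

    Normalise squared lengths by h = 2 / sqrt 3, the least squared length of the
    hexagonal lattice.  With K = pi s h >= 27/5 the summand becomes, up to a factor
    that does not depend on the lattice, [profile K y] = y^2 e^(K (1 - y)), and the
    hexagonal norms become the integers m^2 - m n + n^2 ([hexnorm]).  The six
    shortest vectors contribute 1 each; the other nonzero vectors ([outer]) have
    norm at least 3 and, since e^(- 27/5) <= 1/192, contribute almost nothing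
    ([sum_outer_le]).

    By Selling reduction ([selling_reduction], [reduced_form]) the normalised
    squared length on any unit lattice is p m^2 + q n^2 + r (m - n)^2 with
    0 <= p <= q <= r and p q + q r + r p = 3/4.  Its three basic norms
    y1 = p + q <= y2 = p + r <= y3 = q + r, with sum S, satisfy
    S^2 = 3 + 2 (y1^2 + y2^2 + y3^2), which is the same as
      sum_i (y_i - 1) (y_i - 2) = (S - 3)^2 / 2 >= 0.
    So an inequality profile K y >= 1 + (K - 2) (y - 1) (y - 2), whose two sides are
    tangent at y = 1, gives profile K y1 + profile K y2 + profile K y3 >= 3.
    It holds for y in [0.61, 1.39], even with (y - 1)^2 / 10 added on the right
    ([profile_tangent]).  Three regimes remain to be put together.

    - All y_i in [0.61, 1.39].  The extra square leaves a gain of (S - 3) / 10.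
      The outer vectors are grouped in threes by a symmetry of the hexagonal
      lattice that has order 3 up to sign ([hexrot]); the mean of the norms in a
      group is S / 3 times the hexagonal norm, so convexity of the profile far
      from 0 shows that they lose at most a small multiple of S - 3
      ([sum_profile_near_hex]).
    - y3 > 1.39.  The tangent inequality for y1 and y2, with profile K y3 kept as
      it is, gives more than the whole hexagonal sum ([profile_large_third]).
    - y1 <= 0.61.  Suitable multiples of the shortest vector suffice
      ([profile_multiple]).

    All these are inequalities between finite sums ([hex_comparison]), so they can
    be integrated in s by the mean value theorem, without exchanging a sum and an
    integral ([gain_sum_le]); taking suprema over finite sets finishes the proof. *)

(** * Taylor bounds for the exponential *)

Lemma ge0_from_derive (R : realType) (f df : R -> R) :
  (forall x : R, is_derive x 1 f (df x)) -> 0 <= f 0 ->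
  (forall x, 0 <= x -> 0 <= df x) -> forall x, 0 <= x -> 0 <= f x.
Proof.
move=> fdf f0 df0 x x0.
have cf : {within `[0, x], continuous f}.
  by apply: derivable_within_continuous => y _; apply: ex_derive.
have [c /itvP c0x fE] := @MVT_segment R f df 0 x x0 (fun y _ => fdf y) cf.
have : 0 <= f x - f 0 by rewrite fE subr0 mulr_ge0// df0// c0x.
by rewrite subr_ge0; exact: le_trans.
Qed.

Definition expR_poly (R : realType) (n : nat) : {poly R} :=
  \poly_(i < n) (i`!%:R)^-1.

Lemma deriv_expR_poly (R : realType) (n : nat) :
  (expR_poly R n.+1)^`() = expR_poly R n.
Proof.
apply/polyP => i; rewrite coef_deriv !coef_poly ltnS.
case: ifP => _; last by rewrite mul0rn.
by rewrite factS natrM invfM -mulrnAl -[_ *+ _]mulr_natr mulVf ?mul1r ?pnatr_eq0.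
Qed.

(** The sign e treats e^x and e^(- x) together: the derivative of x |-> e^n
    (e^(e x) - T_n (e x)) is the same function with n - 1 in place of n, so
    nonnegativity for x >= 0 propagates from n = 0, where it says e^(e x) >= 0. *)
Lemma expR_taylor (R : realType) (e : R) (n : nat) (x : R) : e * e = 1 -> 0 <= x ->
  0 <= e ^+ n * (expR (e * x) - (expR_poly R n).[e * x]).
Proof.
move=> ee; elim: n x => [|n IH] x x0.
  by rewrite expr0 mul1r /expR_poly poly_def big_ord0 horner0 subr0 expR_ge0.
move: x x0; apply: (@ge0_from_derive _ _
  (fun x : R => e ^+ n * (expR (e * x) - (expR_poly R n).[e * x]))) => //.
  move=> x.
  have D1 : is_derive x 1 (fun x : R => e * x) e.
    rewrite (_ : (fun x : R => e * x) = e *: (@id R)) //.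
    by apply: is_derive_eq; rewrite /GRing.scale/= mulr1.
  have D2 : is_derive x 1 (fun x : R => expR (e * x)) (expR (e * x) * e).
    by apply: is_derive_eq; rewrite /GRing.scale/= mulrC.
  have D3 : is_derive x 1 (fun x => (expR_poly R n.+1).[e * x])
                      ((expR_poly R n).[e * x] * e).
    have D : is_derive (e * x) 1 (horner (expR_poly R n.+1)) (expR_poly R n).[e * x].
      apply: DeriveDef; first exact: derivable_horner.
      by rewrite -derive1E -derivE deriv_expR_poly.
    by apply: is_derive1_comp.
  apply: is_derive_eq.
  rewrite /GRing.scale/= -mulrBl exprS; ring: ee.
rewrite mulr0 expR0 horner_poly big_ord_recl/= fact0 invr1 mul1r expr0.
by rewrite big1 ?addr0 ?subrr ?mulr0// => i _; rewrite expr0n mulr0.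
Qed.

Lemma expR_poly8E (R : realType) (x : R) : (expR_poly R 8).[x] =
  1 + x + x ^+ 2 / 2 + x ^+ 3 / 6 + x ^+ 4 / 24 + x ^+ 5 / 120 + x ^+ 6 / 720
    + x ^+ 7 / 5040.
Proof.
rewrite horner_poly !big_ord_recr big_ord0 /= !factS fact0; by field.
Qed.

(** An odd-degree Taylor polynomial lies below the exponential on the whole
    line; degree 7 is accurate enough for every numerical bound below. *)
Lemma expR_ge8 (R : realType) (x : R) :
  1 + x + x ^+ 2 / 2 + x ^+ 3 / 6 + x ^+ 4 / 24 + x ^+ 5 / 120 + x ^+ 6 / 720
    + x ^+ 7 / 5040 <= expR x.
Proof.
rewrite -expR_poly8E -subr_ge0.
have [x0|/ltW x0] := leP 0 x.
  by have := expR_taylor 8 (mulr1 1) x0; rewrite expr1n !mul1r.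
have NN : (-1) * (-1) = 1 :> R by rewrite mulrNN mulr1.
have Nx0 : 0 <= - x by rewrite oppr_ge0.
by have := expR_taylor 8 NN Nx0; rewrite -signr_odd expr0 mul1r mulN1r opprK.
Qed.

(** * The normalised summand and its tangent inequality *)

(** The summand r^2 e^(- c r) at r = h y, rescaled to have value 1 at y = 1;
    here K = c h. *)
Definition profile (R : realType) (K y : R) : R := y ^+ 2 * expR (K * (1 - y)).

Lemma profile_ge0 (R : realType) (K y : R) : 0 <= profile K y.
Proof. by rewrite /profile mulr_ge0 ?sqr_ge0 ?expR_ge0. Qed.

(** The profile is an exponential, hence convex, as a function of K; this is
    its tangent line in K at K0. It reduces inequalities for all K >= 27/5 to K
    = 27/5. *)
Lemma profile_convex (R : realType) (K K0 y : R) :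
  profile K0 y * (1 + (K - K0) * (1 - y)) <= profile K y.
Proof.
have -> : profile K y = profile K0 y * expR ((K - K0) * (1 - y)).
  by rewrite /profile -mulrA -expRD; congr (_ * expR _); ring.
by rewrite ler_wpM2l ?profile_ge0// expR_ge1Dx.
Qed.

Lemma profile_le (R : realType) (K K0 y : R) : K0 <= K -> y <= 1 ->
  profile K0 y <= profile K y.
Proof.
move=> leK y1; apply: le_trans (profile_convex K K0 y).
by rewrite ler_peMr ?profile_ge0// lerDl mulr_ge0 ?subr_ge0.
Qed.

Lemma exprS_le_mul (R : realType) (a d : R) (n : nat) : 0 <= d -> d <= a ->
  d ^+ n.+1 <= a ^+ n * d.
Proof.
move=> d0 da; rewrite exprSr ler_wpM2r// lerXn2r// nnegrE.
exact: le_trans da.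
Qed.

(** Both sides have the same value and slope at d = 0. Replacing the
    exponential by its Taylor polynomial of degree 5 leaves d^2 times a
    polynomial that is positive on the interval. *)
Lemma profile_tangent_lt1 (R : realType) (d : R) : 0 <= d <= 39 / 100 ->
  1 + 17 / 5 * (d * (1 + d)) + d ^+ 2 / 10 <= profile (27 / 5) (1 - d).
Proof.
move=> /andP[d0 d1].
have h1 : 0 <= 27 / 5 * d by lra.
rewrite /profile (_ : 1 - (1 - d) = d); last by ring.
have pS n := exprS_le_mul n d0 d1.
have p2 : d ^+ 2 <= 39 / 100 * d by have := pS 1%N; lra.
have p3 : d ^+ 3 <= (39 / 100) ^+ 2 * d by have := pS 2; lra.
have p4 : d ^+ 4 <= (39 / 100) ^+ 3 * d by have := pS 3; lra.
have q0 (n : nat) : 0 <= d ^+ n by rewrite exprn_ge0.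
have : (1 - d) ^+ 2 * (1 + 27 / 5 * d + (27 / 5 * d) ^+ 2 / 2 +
   (27 / 5 * d) ^+ 3 / 6 +
  (27 / 5 * d) ^+ 4 / 24 + (27 / 5 * d) ^+ 5 / 120) <=
  (1 - d) ^+ 2 * expR (27 / 5 * d).
  rewrite ler_wpM2l ?sqr_ge0//; apply: le_trans (expR_ge8 (27 / 5 * d)).
  by have := q0 6; have := q0 7; lra.
apply: le_trans; rewrite -subr_ge0.
rewrite [leRHS](_ : _ = d ^+ 2 * (((27 / 5) ^+ 2 / 2 - 2 * 27 / 5 + 1 - 7 / 2)
  + ((27 / 5) ^+ 3 / 6 - (27 / 5) ^+ 2 + 27 / 5) * d
  + ((27 / 5) ^+ 4 / 24 - (27 / 5) ^+ 3 / 3 + (27 / 5) ^+ 2 / 2) * d ^+ 2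
  + ((27 / 5) ^+ 5 / 120 - (27 / 5) ^+ 4 / 12 + (27 / 5) ^+ 3 / 6) * d ^+ 3
  + (- (27 / 5) ^+ 5 / 60 + (27 / 5) ^+ 4 / 24) * d ^+ 4
  + ((27 / 5) ^+ 5 / 120) * d ^+ 5)); last by field.
by apply: mulr_ge0; [exact: q0 | have := q0 5; lra].
Qed.

(** As for [profile_tangent_lt1], on the other side of y = 1; cancellation in
    the alternating series requires degree 7. *)
Lemma profile_tangent_gt1 (R : realType) (d : R) : 0 <= d <= 39 / 100 ->
  1 - 17 / 5 * (d * (1 - d)) + d ^+ 2 / 10 <= profile (27 / 5) (1 + d).
Proof.
move=> /andP[d0 d1].
have h := expR_ge8 (- (27 / 5 * d)).
rewrite /profile (_ : 27 / 5 * (1 - (1 + d)) = - (27 / 5 * d)); last by ring.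
have := ler_wpM2l (sqr_ge0 (1 + d)) h; apply: le_trans; rewrite -subr_ge0.
set q := (X in 0 <= X).
have -> : q = d ^+ 2 * (((27 / 5) ^+ 2 / 2 - 2 * 27 / 5 + 1 - 7 / 2)
  + (- (27 / 5) ^+ 3 / 6 + (27 / 5) ^+ 2 - 27 / 5) * d
  + ((27 / 5) ^+ 4 / 24 - (27 / 5) ^+ 3 / 3 + (27 / 5) ^+ 2 / 2) * d ^+ 2
  + (- (27 / 5) ^+ 5 / 120 + (27 / 5) ^+ 4 / 12 - (27 / 5) ^+ 3 / 6) * d ^+ 3
  + ((27 / 5) ^+ 6 / 720 - (27 / 5) ^+ 5 / 60 + (27 / 5) ^+ 4 / 24) * d ^+ 4
  + (- (27 / 5) ^+ 7 / 5040 + (27 / 5) ^+ 6 / 360 - (27 / 5) ^+ 5 / 120) * d ^+ 5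
  + (- (27 / 5) ^+ 7 / 2520 + (27 / 5) ^+ 6 / 720) * d ^+ 6
  + (- (27 / 5) ^+ 7 / 5040) * d ^+ 7).
  by rewrite /q; field.
clear q h.
have q0 (n : nat) : 0 <= d ^+ n by rewrite exprn_ge0.
have pS n := exprS_le_mul n d0 d1.
have p2 : d ^+ 2 <= 39 / 100 * d by have := pS 1%N; lra.
have p4 : d ^+ 4 <= 3 / 50 * d by have := pS 3; lra.
have p6 : d ^+ 6 <= d / 110 by have := pS 5; lra.
have p7 : d ^+ 7 <= d / 280 by have := pS 6; lra.
(* The tangent of d^3 at d = 2/5: the bound must be sharp near the right end. *)
have p3 : 12 / 25 * d - 16 / 125 <= d ^+ 3.
  rewrite -subr_ge0 [leRHS](_ : _ = (d - 2 / 5) ^+ 2 * (d + 4 / 5)); last by field.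
  by apply: mulr_ge0; [exact: sqr_ge0 | lra].
apply: mulr_ge0; first exact: q0.
have := q0 5; clear -d0 d1 p2 p3 p4 p6 p7.
move: (d ^+ 2) (d ^+ 3) (d ^+ 4) (d ^+ 5) (d ^+ 6) (d ^+ 7) p2 p3 p4 p6 p7.
move=> d2 d3 d4 d5 d6 d7 p2 p3 p4 p6 p7 p5.
lra.
Qed.

(** This makes the derivative in K of profile K y - (K - 2) (y - 1) (y - 2)
    nonnegative for 1 <= y <= 7/4, so that the tangent inequality passes from K
    = 27/5 to larger K. *)
Lemma profile_gt1_le (R : realType) (d : R) : 0 <= d <= 3 / 4 ->
  profile (27 / 5) (1 + d) <= 1 - d.
Proof.
move=> /andP[d0 d1].
rewrite /profile (_ : 27 / 5 * (1 - (1 + d)) = - (27 / 5 * d)); last by ring.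
rewrite expRN ler_pdivrMr ?expR_gt0//.
have d1' : 0 <= 1 - d by lra.
(* The cubic Taylor polynomial of e^(27 d / 5) is enough here. *)
have q0 n : 0 <= (27 / 5 * d) ^+ n by rewrite exprn_ge0// mulr_ge0.
have e3 : 1 + 27 / 5 * d + (27 / 5 * d) ^+ 2 / 2 + (27 / 5 * d) ^+ 3 / 6
    <= expR (27 / 5 * d).
  apply: le_trans (expR_ge8 (27 / 5 * d)).
  by have := q0 4; have := q0 5; have := q0 6; have := q0 7; lra.
have := ler_wpM2l d1' e3; apply: le_trans; rewrite -subr_ge0.
clear e3 q0.
rewrite [leRHS](_ : _ = d * (12 / 5 + 409 / 50 * d + 1458 / 125 * d ^+ 2
  - 3 / 8 * 27 ^+ 2 / 25 * 12 / 5 * d ^+ 3)); last by field.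
apply: mulr_ge0; first exact: d0.
have p2 : d ^+ 2 <= 3 / 4 * d by exact: (exprS_le_mul 1 d0 d1).
have p3 : d ^+ 3 <= 3 / 4 * d ^+ 2.
  by rewrite exprS; exact: ler_wpM2r (sqr_ge0 d) _ _ d1.
lra.
Qed.

(** The coefficient K - 2 is forced by tangency at y = 1. The quadratic (y - 1)
    (y - 2) is chosen because its sum over the three basic norms of a unit
    lattice is nonnegative, with equality for the hexagonal lattice. The term
    (y - 1)^2 / 10 is slack, spent later on the outer vectors. *)
Lemma profile_tangent (R : realType) (K y : R) : 27 / 5 <= K ->
  61 / 100 <= y <= 139 / 100 ->
  1 + (K - 2) * ((y - 1) * (y - 2)) + (y - 1) ^+ 2 / 10 <= profile K y.
Proof.
move=> K0 /andP[y0 y1]; apply: le_trans (profile_convex K (27 / 5) y).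
have [yle1|/ltW y1le] := leP y 1.
  have hd : 0 <= 1 - y <= 39 / 100 by lra.
  have := profile_tangent_lt1 hd; rewrite subKr.
  set p := profile _ _ => hp.
  have hp2 : 2 - y <= p by nra.
  have : 0 <= (K - 27 / 5) * ((1 - y) * (p - (2 - y))).
    by apply: mulr_ge0; [lra | apply: mulr_ge0; lra].
  lra.
have hd : 0 <= y - 1 <= 39 / 100 by lra.
have hd' : 0 <= y - 1 <= 3 / 4 by lra.
have := profile_tangent_gt1 hd; have := profile_gt1_le hd'.
rewrite [1 + _]addrC subrK.
set p := profile _ _ => hp2 hp.
have : 0 <= (K - 27 / 5) * ((y - 1) * (2 - y - p)).
  by apply: mulr_ge0; [lra | apply: mulr_ge0; lra].
lra.
Qed.

(** * Lattices with a very short vector *)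

Lemma profile_sqr (R : realType) (c y : R) :
  profile (2 * c) y = (y * expR (c * (1 - y))) ^+ 2.
Proof. by rewrite /profile exprMn -expRM_natl mulrA. Qed.

(** The square root y e^(c (1 - y)) of the profile increases up to y = 1 / c
    and decreases afterwards. The hypothesis says that y lies between u and 1 /
    c; then e^t >= 1 + t is enough. *)
Lemma profile_unimodal (R : realType) (c u y : R) : 0 <= u -> 0 <= y ->
  0 <= (y - u) * (1 - c * y) -> profile (2 * c) u <= profile (2 * c) y.
Proof.
move=> u0 y0 h; rewrite !profile_sqr lerXn2r ?nnegrE ?mulr_ge0 ?expR_ge0//.
have -> : c * (1 - y) = c * (1 - u) + c * (u - y) by ring.
rewrite expRD mulrCA mulrC ler_wpM2l ?expR_ge0//.
have := ler_wpM2l y0 (expR_ge1Dx (c * (u - y))).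
apply: le_trans; rewrite -subr_ge0; apply: le_trans h _.
by rewrite le_eqVlt; apply/orP; left; apply/eqP; ring.
Qed.

(** Numerical lower bounds: halving the exponent before applying the Taylor
    polynomial, then squaring, keeps the argument small enough for degree 7. *)
Lemma profile_ge_sqr (R : realType) (y p q : R) : 0 <= y -> 0 <= p ->
  p <= y * (1 + 27 / 10 * (1 - y) + (27 / 10 * (1 - y)) ^+ 2 / 2 +
    (27 / 10 * (1 - y)) ^+ 3 / 6 + (27 / 10 * (1 - y)) ^+ 4 / 24 +
    (27 / 10 * (1 - y)) ^+ 5 / 120 + (27 / 10 * (1 - y)) ^+ 6 / 720 +
    (27 / 10 * (1 - y)) ^+ 7 / 5040) -> q <= p ^+ 2 ->
  q <= profile (27 / 5) y.
Proof.
move=> y0 p0 hp hq; apply: le_trans hq _.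
have -> : 27 / 5 = 2 * (27 / 10) :> R by field.
have := ler_wpM2l y0 (expR_ge8 (27 / 10 * (1 - y))) => /(le_trans hp).
by rewrite profile_sqr => {}hp; rewrite lerXn2r// nnegrE; exact: le_trans hp.
Qed.

(** The interval is split at the maximum 10 / 27 of the profile, and each half
    is bounded by the value at its outer end. *)
Lemma profile_window (R : realType) (y : R) : 21 / 100 <= y <= 61 / 100 ->
  301 / 100 <= profile (27 / 5) y.
Proof.
move=> /andP[y0 y1].
have cE : 27 / 5 = 2 * (27 / 10) :> R by field.
have [y2|/ltW y2] := leP y (10 / 27).
  apply: (@le_trans _ _ (profile (27 / 5) (21 / 100))).
    by apply: (@profile_ge_sqr _ _ (7 / 4)); lra.
  rewrite cE; apply: profile_unimodal; [lra|lra|].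
  by apply: mulr_ge0; lra.
apply: (@le_trans _ _ (profile (27 / 5) (61 / 100))).
  by apply: (@profile_ge_sqr _ _ (87 / 50)); lra.
rewrite cE; apply: profile_unimodal; [lra|lra|].
by rewrite -mulrNN; apply: mulr_ge0; lra.
Qed.

(** Between the windows [0.21, 0.61] of a vector and of its double there is a
    gap, where the two vectors together are large enough. *)
Lemma profile_gap (R : realType) (y : R) : 61 / 400 <= y <= 21 / 100 ->
  301 / 100 <= profile (27 / 5) y + profile (27 / 5) (4 * y).
Proof.
move=> /andP[y0 y1].
have cE : 27 / 5 = 2 * (27 / 10) :> R by field.
have h1 : 2 <= profile (27 / 5) y.
  apply: (@le_trans _ _ (profile (27 / 5) (61 / 400))).
    by apply: (@profile_ge_sqr _ _ (37 / 25)); lra.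
  rewrite cE; apply: profile_unimodal; [lra|lra|].
  by apply: mulr_ge0; lra.
have h2 : 3 / 2 <= profile (27 / 5) (4 * y).
  apply: (@le_trans _ _ (profile (27 / 5) (21 / 25))).
    by apply: (@profile_ge_sqr _ _ (5 / 4)); lra.
  rewrite cE; apply: profile_unimodal; [lra|lra|].
  by rewrite -mulrNN; apply: mulr_ge0; lra.
lra.
Qed.

(** Vectors come in opposite pairs, so 3.01 stands for half of a hexagonal sum:
    3 for the first shell and at most 0.01 for the rest. Take the least k with
    k^2 y >= 0.21: if k >= 3 then k^2 <= 9/4 (k - 1)^2 keeps k^2 y below 0.61,
    and k = 2 leaves only [profile_gap]. *)
Lemma profile_multiple (R : realType) (y : R) : 0 < y <= 61 / 100 ->
  (exists k : nat, [/\ (0 < k)%N, k%:R ^+ 2 * y <= 1 &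
     301 / 100 <= profile (27 / 5) (k%:R ^+ 2 * y)]) \/
  (4 * y <= 1 /\ 301 / 100 <= profile (27 / 5) y + profile (27 / 5) (4 * y)).
Proof.
move=> /andP[y0 y1].
have ex : exists k : nat, 21 / 100 <= k%:R ^+ 2 * y.
  exists (Num.bound y^-1).
  have hb : 1 <= (Num.bound y^-1)%:R * y.
    rewrite -ler_pdivrMr// div1r; apply/ltW.
    by apply: archi_boundP; rewrite invr_ge0 ltW.
  have b0 : 0 <= (Num.bound y^-1)%:R :> R by exact: ler0n.
  move: (Num.bound _)%:R hb b0 => b hb b0; nra.
case: (ex_minnP ex) => k hk kmin.
have [k2|k2] := boolP (k%:R ^+ 2 * y <= 61 / 100).
  left; exists k; split; last by apply: profile_window; rewrite hk k2.
    by rewrite lt0n; apply/eqP => k0; move: hk; rewrite k0 expr0n mul0r; lra.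
  lra.
rewrite -ltNge in k2.
have : (1 < k)%N.
  case: k k2 {hk kmin} => [|[|//]]; first by rewrite expr0n mul0r; lra.
  by rewrite expr1n mul1r; lra.
case: k k2 hk kmin => [//|k] k2 hk kmin k1.
have hk1 : k%:R ^+ 2 * y < 21 / 100.
  by rewrite ltNge; apply/negP => /kmin; rewrite ltnn.
right; case: k k1 k2 hk1 {hk kmin} => [//|[|k]] _ k2 hk1.
  rewrite expr1n mul1r in hk1; split; first lra.
  by apply: profile_gap; apply/andP; split; move: k2; rewrite -natrX; lra.
exfalso; move: k2 hk1; rewrite -[k.+3]addn1 natrD.
have : 2 <= k.+2%:R :> R by rewrite ler_nat.
move: (k.+2%:R) => t t2 k2 hk1.
have : (t + 1) ^+ 2 <= 9 / 4 * t ^+ 2 by nra.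
move=> /(ler_wpM2r (ltW y0)); lra.
Qed.

(** * Lattices whose third basic norm is large *)

Lemma profile_ge_right_end (R : realType) (q u y : R) : 1 <= y <= u ->
  q <= profile (27 / 5) u -> q <= profile (27 / 5) y.
Proof.
move=> /andP[y1 yu] /le_trans; apply.
have -> : 27 / 5 = 2 * (27 / 10) :> R by field.
apply: profile_unimodal; [lra|lra|].
by rewrite -mulrNN; apply: mulr_ge0; lra.
Qed.

(** Applying the tangent inequality to y1 and y2 only gives 2 + (K - 2) rho,
    where rho = (S - 3)^2 / 2 + (y3 - 1) (2 - y3) with S the sum of the norms.
    The relation between the norms bounds S - 3 below by 3 (y3 - 1)^2 / (2 y3),
    and y3 <= y1 + y2 bounds it below by 2 y3 - 3, which suffices for y3 >=
    1.73; for smaller y3 the term profile K y3 makes up what rho lacks. *)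
Lemma profile_large_third (R : realType) (K y1 y2 y3 : R) : 27 / 5 <= K ->
  61 / 100 <= y1 <= 139 / 100 -> 61 / 100 <= y2 <= 139 / 100 ->
  139 / 100 <= y3 -> y3 <= y1 + y2 ->
  (y1 + y2 + y3) ^+ 2 = 3 + 2 * (y1 ^+ 2 + y2 ^+ 2 + y3 ^+ 2) ->
  301 / 100 <= profile K y1 + profile K y2 + profile K y3.
Proof.
move=> K0 h1 h2 h3 h4 hS.
have := profile_tangent K0 h1; have := profile_tangent K0 h2.
set p1 := profile K y1; set p2 := profile K y2 => t2 t1.
pose s := y1 + y2 + y3 - 3.
pose rho := s ^+ 2 / 2 + (y3 - 1) * (2 - y3).
(* Equivalent to p >= 0 in Selling coordinates. *)
have sge : 2 * y3 - 3 <= s by rewrite /s; lra.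
have t12 : 2 + (K - 2) * rho <= p1 + p2.
  have -> : rho = (y1 - 1) * (y1 - 2) + (y2 - 1) * (y2 - 2).
    rewrite /rho /s; lra.
  have := sqr_ge0 (y1 - 1); have := sqr_ge0 (y2 - 1); lra.
(* Solve the relation for y1 + y2 and drop (y1 - y2)^2. *)
have s3 : 3 * (y3 - 1) ^+ 2 <= 2 * y3 * s.
  have := sqr_ge0 (y1 - y2); rewrite /s; lra.
clear t1 t2 hS h1 h2 h4; move: p1 p2 t12 => p1 p2 t12.
have [y3ge|/ltW y3lt] := leP (173 / 100) y3.
  have rge : 3 / 10 <= rho.
    have : (2 * y3 - 3) ^+ 2 <= s ^+ 2 by rewrite lerXn2r ?nnegrE; lra.
    rewrite /rho => hs; nra.
  have := profile_ge0 K y3; nra.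
have hd : 0 <= y3 - 1 <= 3 / 4 by lra.
have := profile_gt1_le hd; have := profile_convex K (27 / 5) y3.
have -> : 1 + (y3 - 1) = y3 by ring.
have lower : 101 / 100 <= 17 / 5 * rho + profile (27 / 5) y3.
  have [y3a|/ltW y3a] := leP y3 (147 / 100).
    have : 33 / 200 <= profile (27 / 5) y3.
      apply: (@profile_ge_right_end _ _ (147 / 100)); first lra.
      by apply: (@profile_ge_sqr _ _ (41 / 100)); lra.
    have : 4 / 25 <= s by nra.
    rewrite /rho; nra.
  have [y3b|/ltW y3b] := leP y3 (8 / 5).
    have : 97 / 1000 <= profile (27 / 5) y3.
      apply: (@profile_ge_right_end _ _ (8 / 5)); first lra.
      by apply: (@profile_ge_sqr _ _ (63 / 200)); lra.
    (* Slightly below the tangent at 31/20 of 3 (y3 - 1)^2 / (2 y3). *)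
    have : 73 / 250 + 219 / 250 * (y3 - 31 / 20) <= s.
      have y30 : 0 < y3 by lra.
      rewrite -(ler_pM2l y30); have := sqr_ge0 (y3 - 31 / 20); lra.
    rewrite /rho; nra.
  have : 1 / 20 <= profile (27 / 5) y3.
    apply: (@profile_ge_right_end _ _ (173 / 100)); first lra.
    by apply: (@profile_ge_sqr _ _ (23 / 100)); lra.
  have : 33 / 100 <= s by nra.
  rewrite /rho; nra.
have rge : (y3 - 1) * (2 - y3) <= rho.
  by rewrite /rho; have := sqr_ge0 s; lra.
move: (profile (27 / 5) y3) (profile K y3) rho rge lower t12.
move=> q3 p3 rho rge lower t12 h5 h6.
have : 0 <= (K - 27 / 5) * (rho - (y3 - 1) * q3).
  apply: mulr_ge0; first lra.
  have := ler_wpM2l (_ : 0 <= y3 - 1) h6; lra.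
lra.
Qed.

(** * The tail of the hexagonal sum *)

Lemma ler_sum_uniq_sub (R : numDomainType) (I : eqType) (s t : seq I) (F : I -> R) :
  uniq s -> uniq t -> {subset s <= t} -> (forall i, 0 <= F i) ->
  \sum_(i <- s) F i <= \sum_(i <- t) F i.
Proof.
move=> us ut st F0.
have pe : perm_eq [seq i <- t | i \in s] s.
  apply: uniq_perm => //; first exact: filter_uniq.
  by move=> i; rewrite mem_filter; case: (boolP (i \in s)) => // /st ->.
rewrite [leRHS](bigID [in s]) /= -[X in _ <= X + _]big_filter (perm_big _ pe) /= lerDl.
exact: sumr_ge0.
Qed.

Lemma sum_half_pow (R : realType) (n : nat) :
  \sum_(i < n) (2^-1 : R) ^+ i = 2 - 2 * 2^-1 ^+ n.
Proof.
elim: n => [|n IH]; first by rewrite big_ord0 expr0; ring.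
by rewrite big_ord_recr /= IH exprS; field.
Qed.

(** The nonnegative integers contribute at most 2 and the negative ones at most
    1. *)
Lemma sum_half_abs (R : realType) (s : seq int) : uniq s ->
  \sum_(m <- s) (2^-1 : R) ^+ `|m|%N <= 3.
Proof.
move=> us; have [N hN] : exists N, forall m, m \in s -> (`|m| < N)%N.
  by exists (\max_(m <- s) `|m|%N).+1 => m ms; rewrite ltnS; exact: leq_bigmax_seq.
pose t := [seq Posz i | i <- iota 0 N] ++ [seq Negz i | i <- iota 0 N].
have h0 k : 0 <= (2^-1 : R) ^+ k by rewrite exprn_ge0// invr_ge0.
have ut : uniq t.
  rewrite cat_uniq !map_inj_uniq ?iota_uniq ?andbT/=; try by move=> ? ? [].
  by apply/hasPn => _ /mapP[i _ ->]; apply/mapP => -[].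
have st : {subset s <= t}.
  move=> m ms; have mN := hN m ms.
  rewrite mem_cat; case: m {ms} mN => k kN; apply/orP; [left|right];
    apply/mapP; exists k; rewrite // mem_iota /=; [exact: kN|exact: ltnW kN].
apply: le_trans (ler_sum_uniq_sub us ut st _) _ => //.
rewrite big_cat /= !big_map /=.
have iE : iota 0 N = index_iota 0 N by rewrite /index_iota subn0.
rewrite iE !big_mkord sum_half_pow.
under eq_bigr do rewrite exprS.
rewrite -mulr_sumr sum_half_pow; have := h0 N; lra.
Qed.

Lemma sum_half_abs2 (R : realType) (s : seq (int * int)) : uniq s ->
  \sum_(v <- s) (2^-1 : R) ^+ (`|v.1| + `|v.2|)%N <= 9.
Proof.
move=> us; pose s1 := undup (unzip1 s); pose s2 := undup (unzip2 s).
have h0 k : 0 <= (2^-1 : R) ^+ k by rewrite exprn_ge0// invr_ge0.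
pose t := [seq (m, n) | m <- s1, n <- s2].
have ut : uniq t by rewrite allpairs_uniq ?undup_uniq// => -[? ?] [? ?].
have st : {subset s <= t}.
  move=> [m n] mn; apply/allpairsP; exists (m, n); split=> //=;
    rewrite mem_undup; apply/mapP; by exists (m, n).
apply: le_trans (ler_sum_uniq_sub us ut st _) _ => //.
rewrite big_allpairs /=.
under eq_bigr => m _ do (under eq_bigr => n _ do rewrite exprD; rewrite -mulr_sumr).
rewrite -mulr_suml; apply: (@le_trans _ _ (3 * 3)); last by lra.
by apply: ler_pM; rewrite ?sumr_ge0 ?sum_half_abs ?undup_uniq.
Qed.

Definition hexnorm (v : int * int) : int :=
  v.1 ^+ 2 - v.1 * v.2 + v.2 ^+ 2.

Definition hexshell : seq (int * int) :=
  [:: (1, 0); (-1, 0); (0, 1); (0, -1); (1, 1); (-1, -1)].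

Definition outer (v : int * int) : bool := (v != (0, 0)) && (v \notin hexshell).

(** The second inequality turns decay in the norm into decay in |m| + |n|,
    which can be summed coordinatewise. Its constants are such that 2^(6 j) /
    2^15 >= 2^(|m| + |n|); equality holds for (2, 1). For |m| + |n| >= 4 it
    follows from (|m| + |n|)^2 <= 4 hexnorm, and the remaining vectors are
    enumerated. *)
Lemma hexnorm_outer (v : int * int) : outer v ->
  exists2 j : nat, hexnorm v = j & (3 <= j)%N && (`|v.1| + `|v.2| + 15 <= 6 * j)%N.
Proof.
case: v => m n; rewrite /outer /hexnorm /= => h.
have X0 : 0 <= m ^+ 2 - m * n + n ^+ 2.
  have : 0 <= (2 * m - n) ^+ 2 + 3 * n ^+ 2.
    by apply: addr_ge0; [|apply: mulr_ge0 => //]; exact: sqr_ge0.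
  lra.
exists `|(m ^+ 2 - m * n + n ^+ 2)%R|%N; first by rewrite gez0_abs.
have [hmn|hmn] := leqP (`|m| + `|n|) 3; last first.
  have : (`|m|%:Z + `|n|%:Z) ^+ 2 <= 4 * (m ^+ 2 - m * n + n ^+ 2).
    rewrite -subr_ge0.
    have hm : `|m|%:Z ^+ 2 = m ^+ 2 by rewrite abszE -normrX ger0_norm ?sqr_ge0.
    have hn : `|n|%:Z ^+ 2 = n ^+ 2 by rewrite abszE -normrX ger0_norm ?sqr_ge0.
    have [hmn0|hmn0] : `|m|%:Z * `|n|%:Z = m * n \/ `|m|%:Z * `|n|%:Z = - (m * n).
      by rewrite !abszE -normrM; have [_|_] := ger0P (m * n); [left|right].
    - by have := sqr_ge0 (m - n); lra.
    - by have := sqr_ge0 (m - n); have := sqr_ge0 (m + n); lra.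
  move: X0; move: (m ^+ 2 - m * n + n ^+ 2) => X X0.
  have l4 : 4 <= `|m|%:Z + `|n|%:Z by lia.
  move=> lX; have : `|m|%:Z + `|n|%:Z <= X by nra.
  lia.
have [a [a7 mE]] : exists a : nat, (a < 7)%N /\ m = a%:Z - 3.
  by exists `|(m + 3)%R|%N; lia.
have [b [b7 nE]] : exists b : nat, (b < 7)%N /\ n = b%:Z - 3.
  by exists `|(n + 3)%R|%N; lia.
move: h hmn; rewrite {}mE {}nE => {X0}.
by move: a a7 => [|[|[|[|[|[|[|//]]]]]]] _; move: b b7 => [|[|[|[|[|[|[|//]]]]]]] _.
Qed.

Lemma cube_le_exp3 (j : nat) : (3 <= j)%N -> (j ^ 3 <= 3 ^ j)%N.
Proof.
elim: j => // j IH; rewrite ltnS leq_eqVlt => /predU1P[<-//|j3].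
have {}IH := IH j3; rewrite expnS [(3 ^ _)%N]expnS.
have : (j.+1 ^ 3 <= 3 * j ^ 3)%N by rewrite !expnS !expn0; nia.
by rewrite -expnS => /leq_trans; apply; rewrite leq_pmul2l.
Qed.

(** Here 192 = 3 * 2^6: the factor 3^j absorbs j^3 and the factor 2^(6 j)
    absorbs 2^(l + 15). *)
Lemma hexnorm_outer_pow (R : realType) (j l : nat) :
  (3 <= j)%N -> (l + 15 <= 6 * j)%N ->
  j%:R ^+ 3 * 192^-1 ^+ j.-1 <= 3 / 512 * 2^-1 ^+ l :> R.
Proof.
move=> j3 lj.
have h3 : j%:R ^+ 3 <= 3 ^+ j :> R by rewrite -!natrX ler_nat cube_le_exp3.
have h2 : 2 ^+ l * 2 ^+ 15 <= (2 ^+ 6) ^+ j :> R.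
  by rewrite -exprD -exprM; apply: ler_weXn2l => //; lra.
have := ler_pM (exprn_ge0 3 (ler0n R j)) _ h3 h2.
rewrite -exprMn (_ : 3 * 2 ^+ 6 = 192 :> R); last by ring.
have -> : 192 ^+ j = 192 * 192 ^+ j.-1 :> R.
  by rewrite -exprS prednK// (ltnW (ltnW j3)).
rewrite !exprVn.
have a0 : 0 < 2 ^+ l :> R by rewrite exprn_gt0.
have b0 : 0 < 192 ^+ j.-1 :> R by apply: exprn_gt0; lra.
move: (j%:R ^+ 3) (2 ^+ l) (192 ^+ j.-1) a0 b0 => x a b a0 b0 h.
rewrite ler_pdivrMr// mulrAC ler_pdivlMr//.
have {}h : x * (a * 2 ^+ 15) <= 192 * b.
  by apply: h; rewrite mulr_ge0 ?exprn_ge0// ltW.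
lra.
Qed.

Lemma expRN_rate_le (R : realType) : expR (- (27 / 5)) <= 192^-1 :> R.
Proof.
suff h : 192 <= expR (27 / 5) :> R.
  by rewrite expRN lef_pV2 ?posrE ?expR_gt0 ?ltr0n.
have -> : 27 / 5 = 2 * (27 / 10) :> R by field.
rewrite expRM_natl.
have h : 14 <= expR (27 / 10) :> R by apply: le_trans (expR_ge8 _); lra.
nra.
Qed.

(** The first bound controls the hexagonal tail itself, the second one its
    first variation when the lattice is deformed; at norms at least 3, K times
    the profile is still decreasing in K for K >= 27/5. *)
Lemma profile_outer (R : realType) (K : R) (v : int * int) : 27 / 5 <= K ->
  outer v ->
  profile K (hexnorm v)%:~R <= 1 / 512 * 2^-1 ^+ (`|v.1| + `|v.2|)%N /\
  K * (hexnorm v)%:~R * profile K (hexnorm v)%:~R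
    <= 81 / 2560 * 2^-1 ^+ (`|v.1| + `|v.2|)%N.
Proof.
move=> K0 /hexnorm_outer[j -> /andP[j3]]; move: (`|v.1| + `|v.2|)%N => l lj.
have jl := hexnorm_outer_pow R j3 lj.
have jE : j%:R = 1 + j.-1%:R :> R by rewrite nat1r prednK// (ltnW (ltnW j3)).
have j1 : 2 <= j.-1%:R :> R by rewrite ler_nat -ltnS prednK// (ltnW (ltnW j3)).
have -> : (Posz j)%:~R = j%:R :> R by [].
pose u := expR ((K - 27 / 5) * - j.-1%:R).
have pE : profile K j%:R = j%:R ^+ 2 * (expR (- (27 / 5)) ^+ j.-1 * u).
  by rewrite /profile -expRM_natr -expRD; congr (_ * expR _); rewrite jE; ring.
have u0 : 0 <= u by exact: expR_ge0.
have Ku : K * u <= 27 / 5.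
  have : expR ((K - 27 / 5) * j.-1%:R) * u = 1.
    by rewrite /u mulrN expRxMexpNx_1.
  move: (expR_ge1Dx ((K - 27 / 5) * j.-1%:R)); set E := expR _ => hE Eu.
  have KE : K <= 27 / 5 * E by nra.
  by have := ler_wpM2r u0 KE; rewrite -(mulrA (27 / 5)) Eu mulr1.
have u1 : u <= 1 by rewrite /u expR_le1; nra.
have hq : expR (- (27 / 5)) ^+ j.-1 <= 192^-1 ^+ j.-1 :> R.
  by rewrite lerXn2r ?nnegrE ?expR_ge0 ?invr_ge0 ?ler0n ?expRN_rate_le.
have q0 : 0 <= expR (- (27 / 5)) ^+ j.-1 :> R by rewrite exprn_ge0 ?expR_ge0.
rewrite {}pE; clearbody u.
move: (expR _ ^+ _) (192^-1 ^+ _) (2^-1 ^+ l) hq q0 jl => q Q h hq q0 jl.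
have j3' : 3 <= j%:R :> R by rewrite ler_nat.
have J2 : 0 <= j%:R ^+ 2 :> R by exact: sqr_ge0.
have h1 : j%:R ^+ 2 * q <= 1 / 512 * h.
  have : j%:R * (j%:R ^+ 2 * q) <= j%:R * (j%:R ^+ 2 * Q).
    by rewrite !ler_wpM2l.
  have : 3 * (j%:R ^+ 2 * q) <= j%:R * (j%:R ^+ 2 * q).
    by rewrite ler_wpM2r// mulr_ge0.
  by rewrite exprS in jl; lra.
have h2 : j%:R * (j%:R ^+ 2 * q) <= 3 / 512 * h.
  apply: le_trans jl; rewrite [_ ^+ 3]exprS -mulrA.
  by rewrite !ler_wpM2l.
split.
  rewrite mulrA; apply: le_trans h1; rewrite ler_piMr// mulr_ge0//.
have p0 : 0 <= j%:R * (j%:R ^+ 2 * q) by rewrite !mulr_ge0.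
rewrite (_ : _ * _ * _ = (K * u) * (j%:R * (j%:R ^+ 2 * q))); last by ring.
apply: le_trans (ler_wpM2r p0 Ku) _.
lra.
Qed.

(** * Convexity of the summand at distant vectors *)

Lemma expR_ge_quad (R : realType) (x : R) : 0 <= x ->
  1 + x + x ^+ 2 / 2 <= expR x.
Proof.
move=> x0; have := expR_taylor 3 (mulr1 1) x0.
rewrite expr1n !mul1r subr_ge0; apply: le_trans.
by rewrite horner_poly !big_ord_recr big_ord0 /= !factS fact0 le_eqVlt; apply/orP; left;
  apply/eqP; field.
Qed.

Lemma expRN_ge_quad (R : realType) (x : R) : 0 <= x <= 1 ->
  1 - x + x ^+ 2 / 3 <= expR (- x).
Proof.
move=> /andP[x0 x1]; have NN : (-1) * (-1) = 1 :> R by rewrite mulrNN mulr1.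
have := expR_taylor 4 NN x0.
rewrite -signr_odd expr0 mul1r mulN1r subr_ge0; apply: le_trans.
rewrite horner_poly !big_ord_recr big_ord0 /= !factS fact0 -subr_ge0.
rewrite [leRHS](_ : _ = x ^+ 2 * (1 - x) / 6); last by field.
by rewrite mulr_ge0 ?mulr_ge0 ?sqr_ge0 ?subr_ge0 ?invr_ge0.
Qed.

(** With e = 1 - y / j and M = K j this is the tangent line at j of the
    profile, normalised by its value at j. The profile is convex only beyond (2
    + sqrt 2) / K, hence the condition on M (1 - e) = K y. *)
Lemma sqr_expR_tangent (R : realType) (M e : R) : 16 <= M -> 4 <= M * (1 - e) ->
  1 + (M - 2) * e <= (1 - e) ^+ 2 * expR (M * e).
Proof.
move=> M16 h4.
have [e0|/ltW e0] := leP 0 e.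
  have x0 : 0 <= M / 2 * e by rewrite mulr_ge0//; lra.
  have e1 : 0 <= 1 - e by nra.
  have := ler_wpM2l e1 (expR_ge_quad x0).
  have -> : M * e = 2 * (M / 2 * e) by field.
  rewrite expRM_natl -exprMn; set E := _ * expR _ => hE.
  have : 1 + (M / 2 - 1) * e <= E.
    apply: le_trans hE; rewrite -subr_ge0.
    rewrite [leRHS](_ : _ = e ^+ 2 * (M / 8 * (M * (1 - e) - 4))); last by field.
    by apply: mulr_ge0; [exact: sqr_ge0 | apply: mulr_ge0; lra].
  have : 0 <= (M / 2 - 1) * e by rewrite mulr_ge0//; lra.
  nra.
pose d := - e; have d0 : 0 <= d by rewrite oppr_ge0.
have -> : e = - d by rewrite opprK.
have [big|small] := leP 1 ((M - 2) * d).
  apply: (@le_trans _ _ 0); first lra.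
  by rewrite mulr_ge0 ?sqr_ge0 ?expR_ge0.
have x01 : 0 <= (M - 2) * d <= 1.
  by apply/andP; split; [rewrite mulr_ge0//; lra | exact: ltW].
have := expRN_ge_quad x01.
have -> : M * - d = - ((M - 2) * d) + 2 * - d by ring.
rewrite expRD expRM_natl.
have hd : 14 * d <= (M - 2) * d by rewrite ler_wpM2r//; lra.
have -> : 1 + (M - 2) * - d = 1 - (M - 2) * d by ring.
move: ((M - 2) * d) x01 hd => x /andP[x0 x1] hd.
have := expR_ge1Dx (- d); move: (expR (- x)) (expR (- d)) => E1 E2 hE2 hE1.
have h2 : 1 - 2 * d ^+ 2 <= ((1 + d) * E2) ^+ 2.
  have h1 : 1 - d ^+ 2 <= (1 + d) * E2 by nra.
  have h0 : 0 <= 1 - d ^+ 2 by nra.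
  have := sqr_ge0 (d ^+ 2); nra.
have h3 : 0 <= 1 - 2 * d ^+ 2 by nra.
have h4' : 0 <= 1 - x + x ^+ 2 / 3 by nra.
rewrite opprK mulrCA -exprMn.
apply: le_trans (ler_pM h4' h3 hE1 h2).
have : 196 * d ^+ 2 <= x ^+ 2 by nra.
nra.
Qed.

Lemma profile_tangent_far (R : realType) (K j y : R) : 27 / 5 <= K -> 3 <= j ->
  3 / 2 <= y -> profile K j * (1 + (K - 2 / j) * (j - y)) <= profile K y.
Proof.
move=> K0 j3 y1; have j0 : j != 0 by rewrite gt_eqF//; lra.
have M16 : 16 <= K * j by nra.
have M4 : 4 <= K * j * (1 - (1 - y / j)).
  have -> : K * j * (1 - (1 - y / j)) = K * y by field.
  by nra.
have := sqr_expR_tangent M16 M4.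
have -> : K * j * (1 - y / j) = K * (j - y) by field.
have -> : 1 + (K * j - 2) * (1 - y / j) = 1 + (K - 2 / j) * (j - y) by field.
have -> : 1 - (1 - y / j) = y / j by ring.
move=> /(ler_wpM2l (profile_ge0 K j)) /le_trans; apply.
rewrite /profile [leLHS](_ : _ = (j * (y / j)) ^+ 2 *
  (expR (K * (1 - j)) * expR (K * (j - y)))); last by ring.
rewrite -expRD (_ : j * (y / j) = y); last by field.
by rewrite (_ : _ + _ = K * (1 - y)); last ring.
Qed.

(** * Reduced forms and their vectors outside the first shell *)

(** Selling form: p, q and r are minus the pairwise scalar products of three
    vectors with sum 0, two of which form a basis. *)
Definition qform (R : realType) (p q r : R) (v : int * int) : R :=
  p * v.1%:~R ^+ 2 + q * v.2%:~R ^+ 2 + r * (v.1 - v.2)%:~R ^+ 2.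

(** A rotation of order 6 of the hexagonal lattice; on quadratic forms in
    Selling coordinates it permutes p, q and r cyclically. *)
Definition hexrot (v : int * int) : int * int := (v.1 - v.2, v.1).

Lemma hexrot_inj : injective hexrot.
Proof. by move=> [a b] [c d] [h ac]; congr (_, _); lia. Qed.

Lemma qform_hexrot (R : realType) (p q r : R) (v : int * int) :
  qform p q r (hexrot v) = qform q r p v.
Proof.
rewrite /qform /hexrot /= (_ : v.1 - v.2 - v.1 = - v.2); last by lia.
by rewrite rmorphN sqrrN; ring.
Qed.

Lemma hexnormE (R : realType) (v : int * int) :
  (hexnorm v)%:~R = qform (2^-1) (2^-1) (2^-1) v :> R.
Proof.
by rewrite /hexnorm /qform !(rmorphD, rmorphN, rmorphM, rmorphXn)/=; field.
Qed.

(** Averaging a form over the rotations by powers of [hexrot] gives a multiple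
    of the hexagonal form, the only invariant one up to scaling. *)
Lemma qform_hexrot_sum (R : realType) (p q r : R) (v : int * int) :
  qform p q r v + qform q r p v + qform r p q v
    = 2 * (p + q + r) * (hexnorm v)%:~R.
Proof. by rewrite hexnormE /qform; field. Qed.

Lemma intr_sqr_ge1 (R : realType) (m : int) : m != 0 -> 1 <= m%:~R ^+ 2 :> R.
Proof.
move=> m0; rewrite -[1]/(1%:~R) -rmorphXn ler_int.
have := sqr_ge0 m; have : m ^+ 2 != 0 by rewrite expf_neq0.
lia.
Qed.

Lemma intr_sqr_ge4 (R : realType) (m : int) : m \notin [:: 0; 1; -1] ->
  4 <= m%:~R ^+ 2 :> R.
Proof.
move=> m0; rewrite -[4]/(4%:~R) -rmorphXn ler_int.
move: m0; rewrite !inE => h; have : (2 <= m) || (m <= -2) by lia.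
by case/orP => ?; nia.
Qed.

(** If m, n and m - n are all nonzero the form is at least p + q + r; otherwise
    v is a multiple, by at least 2, of a vector of the first shell. *)
Lemma qform_outer (R : realType) (p q r : R) (v : int * int) :
  0 <= p -> 0 <= q -> 0 <= r -> 3 / 2 <= p + q + r ->
  61 / 100 <= p + q -> 61 / 100 <= p + r -> 61 / 100 <= q + r ->
  outer v -> 3 / 2 <= qform p q r v.
Proof.
case: v => m n p0 q0 r0 pqr pq pr qr; rewrite /outer !inE !xpair_eqE /= => h.
rewrite /qform /=.
have [m0|m0] := eqVneq m 0.
  have := @intr_sqr_ge4 R n; rewrite !inE => n4.
  have {}n4 : 4 <= n%:~R ^+ 2 :> R by apply: n4; lia.
  have -> : (m - n)%:~R ^+ 2 = n%:~R ^+ 2 :> R by rewrite m0 sub0r rmorphN sqrrN.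
  rewrite m0 expr0n mulr0; nra.
have [n0|n0] := eqVneq n 0.
  have := @intr_sqr_ge4 R m; rewrite !inE => m4.
  have {}m4 : 4 <= m%:~R ^+ 2 :> R by apply: m4; lia.
  rewrite n0 subr0 expr0n mulr0; nra.
have [mn|mn] := eqVneq m n.
  have := @intr_sqr_ge4 R m; rewrite !inE => m4.
  have {}m4 : 4 <= m%:~R ^+ 2 :> R by apply: m4; lia.
  rewrite -mn subrr expr0n mulr0; nra.
have m1 := @intr_sqr_ge1 R m m0; have n1 := @intr_sqr_ge1 R n n0.
have := @intr_sqr_ge1 R (m - n); rewrite subr_eq0 => /(_ mn) mn1.
have := ler_wpM2l p0 m1; have := ler_wpM2l q0 n1; have := ler_wpM2l r0 mn1.
lra.
Qed.

Lemma profile0 (R : realType) (K : R) : profile K 0 = 0.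
Proof. by rewrite /profile expr0n mul0r. Qed.

Lemma profile1 (R : realType) (K : R) : profile K 1 = 1.
Proof. by rewrite /profile subrr mulr0 expR0 expr1n mulr1. Qed.

Lemma big_hexshell (R : realType) (F : int * int -> R) :
  \sum_(v <- hexshell) F v = F (1, 0) + F (-1, 0) + F (0, 1) + F (0, -1)
    + F (1, 1) + F (-1, -1).
Proof. by rewrite !big_cons big_nil addr0 !addrA. Qed.

Lemma sum_hexshell (R : realType) (K p q r : R) :
  \sum_(v <- hexshell) profile K (qform p q r v) =
  2 * (profile K (p + q) + profile K (p + r) + profile K (q + r)).
Proof.
rewrite big_hexshell /qform /= !subr0 !sub0r !subrr.
rewrite !(expr0n, mulr0, addr0, add0r, rmorphN, sqrrN, expr1n, mulr1, opprK).
ring.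
Qed.

Lemma sum_hexnorm_le (R : realType) (K : R) (s : seq (int * int)) : uniq s ->
  \sum_(v <- s) profile K (hexnorm v)%:~R <=
    6 + \sum_(v <- s | outer v) profile K (hexnorm v)%:~R.
Proof.
move=> us; pose t := (0, 0) :: hexshell ++ [seq v <- s | outer v].
have ut : uniq t.
  have o0 : outer (0, 0) = false by [].
  rewrite /t cons_uniq cat_uniq filter_uniq// andbT mem_cat mem_filter o0 orbF.
  apply/and3P; split => //.
  by apply/hasPn => v; rewrite mem_filter => /andP[/andP[]].
have st : {subset s <= t}.
  move=> v vs; rewrite inE mem_cat mem_filter vs andbT /outer.
  by case: (v == _) => //=; case: (v \in hexshell).
apply: le_trans (ler_sum_uniq_sub us ut st _) _ => [v|]; first exact: profile_ge0.
rewrite /t big_cons big_cat /= big_filter profile0 add0r lerD2r.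
under eq_bigr do rewrite hexnormE; rewrite sum_hexshell.
have -> : 2^-1 + 2^-1 = 1 :> R by field.
rewrite profile1; lra.
Qed.

(** The geometric series over all pairs of integers has sum 9; the resulting
    constants 9/512 and 729/2560 are rounded up. *)
Lemma sum_outer_le (R : realType) (K : R) (s : seq (int * int)) :
  27 / 5 <= K -> uniq s ->
  \sum_(v <- s | outer v) profile K (hexnorm v)%:~R <= 1 / 50 /\
  \sum_(v <- s | outer v) K * (hexnorm v)%:~R * profile K (hexnorm v)%:~R
    <= 3 / 10.
Proof.
move=> K0 us; have := @sum_half_abs2 R _ (filter_uniq outer us).
rewrite big_filter => h9; split.
  apply: (@le_trans _ _ (1 / 512 * 9)); last by lra.
  apply: le_trans (ler_wpM2l _ h9); last by lra.
  rewrite mulr_sumr; apply: ler_sum => v ov.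
  by have [] := profile_outer K0 ov.
apply: (@le_trans _ _ (81 / 2560 * 9)); last by lra.
apply: le_trans (ler_wpM2l _ h9); last by lra.
rewrite mulr_sumr; apply: ler_sum => v ov.
by have [] := profile_outer K0 ov.
Qed.

(** * Comparison at a fixed rate *)

(** The hypothesis on the y_i gives sum (y_i - 1) (y_i - 2) = (S - 3)^2 / 2 and
    sum (y_i - 1)^2 = (S - 1) (S - 3) / 2 for their sum S. *)
Lemma sum_profile_tangent (R : realType) (K y1 y2 y3 : R) : 27 / 5 <= K ->
  61 / 100 <= y1 <= 139 / 100 -> 61 / 100 <= y2 <= 139 / 100 ->
  61 / 100 <= y3 <= 139 / 100 ->
  (y1 + y2 + y3) ^+ 2 = 3 + 2 * (y1 ^+ 2 + y2 ^+ 2 + y3 ^+ 2) ->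
  3 <= y1 + y2 + y3 ->
  3 + (y1 + y2 + y3 - 3) / 10 <= profile K y1 + profile K y2 + profile K y3.
Proof.
move=> K0 h1 h2 h3 hS S3.
have := profile_tangent K0 h1; have := profile_tangent K0 h2.
have := profile_tangent K0 h3.
set p1 := profile K y1; set p2 := profile K y2; set p3 := profile K y3.
move=> t3 t2 t1.
set S := y1 + y2 + y3 in hS S3 *.
have sE : (y1 - 1) * (y1 - 2) + (y2 - 1) * (y2 - 2) + (y3 - 1) * (y3 - 2) =
  (S - 3) ^+ 2 / 2 by rewrite /S in hS *; lra.
have dE : (y1 - 1) ^+ 2 + (y2 - 1) ^+ 2 + (y3 - 1) ^+ 2 =
  (S - 1) * (S - 3) / 2 by rewrite /S in hS *; lra.
have : 0 <= (K - 2) * ((S - 3) ^+ 2 / 2).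
  apply: mulr_ge0; first lra.
  by apply: mulr_ge0; [exact: sqr_ge0 | lra].
have : 2 * (S - 3) <= (S - 1) * (S - 3) by rewrite ler_wpM2r; lra.
rewrite -sE; move: dE t1 t2 t3; clear; lra.
Qed.

(** The first shell gains 6 (S - 3) / 10 over its hexagonal value 18. By
    convexity at the hexagonal norm j, a group of three outer vectors of mean
    norm S j / 3 loses at most (S - 3) K j (profile K j), and by [sum_outer_le]
    these losses add up to at most 3 (S - 3) / 10. *)
Lemma sum_profile_near_hex (R : realType) (K p q r : R) (s : seq (int * int)) :
  27 / 5 <= K -> 0 <= p -> 0 <= q -> 0 <= r -> p * q + q * r + r * p = 3 / 4 ->
  61 / 100 <= p + q <= 139 / 100 -> 61 / 100 <= p + r <= 139 / 100 ->
  61 / 100 <= q + r <= 139 / 100 -> uniq s ->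
  3 * (\sum_(v <- s) profile K (hexnorm v)%:~R) <=
    \sum_(v <- hexshell ++ [seq v <- s | outer v])
      (profile K (qform p q r v) + profile K (qform q r p v)
        + profile K (qform r p q v)).
Proof.
move=> K0 p0 q0 r0 pqr hpq hpr hqr us.
have [w1 w2] := sum_outer_le K0 us.
have w0 := sum_hexnorm_le K us.
have S3 : 3 / 2 <= p + q + r.
  have : (3 / 2) ^+ 2 <= (p + q + r) ^+ 2.
    have := sqr_ge0 (p - q); have := sqr_ge0 (p - r); have := sqr_ge0 (q - r); lra.
  by move=> h; rewrite leNgt; apply/negP => lt; nra.
have S3' : 3 <= p + q + (p + r) + (q + r) by lra.
have hS : (p + q + (p + r) + (q + r)) ^+ 2 =
   3 + 2 * ((p + q) ^+ 2 + (p + r) ^+ 2 + (q + r) ^+ 2) by lra.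
have := sum_profile_tangent K0 hpq hpr hqr hS S3'.
rewrite big_cat /= big_filter /=.
have -> : \sum_(v <- hexshell) (profile K (qform p q r v) + profile K (qform q r p v)
        + profile K (qform r p q v)) =
   6 * (profile K (p + q) + profile K (p + r) + profile K (q + r)).
  by rewrite !big_split /= !sum_hexshell [q + p]addrC [r + p]addrC [r + q]addrC; ring.
have : 3 * (\sum_(v <- s | outer v) profile K (hexnorm v)%:~R) -
   (p + q + (p + r) + (q + r) - 3) *
     \sum_(v <- s | outer v) K * (hexnorm v)%:~R * profile K (hexnorm v)%:~R
  <= \sum_(v <- s | outer v)
   (profile K (qform p q r v) + profile K (qform q r p v) + profile K (qform r p q v)).
  rewrite !mulr_sumr -sumrB; apply: ler_sum => v ov.
  have [pq1 pq2] := andP hpq; have [pr1 pr2] := andP hpr; have [qr1 qr2] := andP hqr.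
  have y1 : 3 / 2 <= qform p q r v by apply: qform_outer.
  have y2 : 3 / 2 <= qform q r p v by apply: qform_outer => //; lra.
  have y3 : 3 / 2 <= qform r p q v by apply: qform_outer => //; lra.
  have j3 : 3 <= (hexnorm v)%:~R :> R.
    by have [j -> /andP[j3 _]] := hexnorm_outer ov; rewrite ler_nat.
  have := profile_tangent_far K0 j3 y1; have := profile_tangent_far K0 j3 y2.
  have := profile_tangent_far K0 j3 y3.
  have := qform_hexrot_sum p q r v; have := profile_ge0 K (hexnorm v)%:~R.
  move: (qform p q r v) (qform q r p v) (qform r p q v) (hexnorm v)%:~R j3 => a b c j j3.
  move: (profile K j) (profile K a) (profile K b) (profile K c).
  move=> w wa wb wc w_ge0 abc h1 h2 h3.
  have -> : 3 * w - (p + q + (p + r) + (q + r) - 3) * (K * j * w) =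
    w * (3 + K * (3 * j - (a + b + c))) by rewrite abc; ring.
  have h4 : w * (3 + (K - 2 / j) * (3 * j - (a + b + c))) <= wa + wb + wc by lra.
  apply: le_trans h4; rewrite ler_wpM2l// lerD2l abc.
  have : 0 <= 2 / j * (j * (2 * (p + q + r) - 3)).
    by rewrite mulr_ge0 ?mulr_ge0 ?invr_ge0//; lra.
  by lra.
have : (p + q + (p + r) + (q + r) - 3) *
     \sum_(v <- s | outer v) K * (hexnorm v)%:~R * profile K (hexnorm v)%:~R
   <= (p + q + (p + r) + (q + r) - 3) * (3 / 10).
  by apply: ler_wpM2l => //; lra.
lra.
Qed.

Lemma sum_profile_diag (R : realType) (K p q r : R) (k : nat) :
  \sum_(v <- [:: (k%:Z, k%:Z); (- k%:Z, - k%:Z)]) profile K (qform p q r v)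
    = 2 * profile K (k%:R ^+ 2 * (p + q)).
Proof.
rewrite !big_cons big_nil /qform /= !subrr !expr0n !mulr0 !addr0 !rmorphN !sqrrN.
rewrite -[k%:~R]/(k%:R : R) (_ : p * _ + q * _ = k%:R ^+ 2 * (p + q)); ring.
Qed.

(** Three index lists, rather than one, appear because near the hexagonal
    lattice only the sum over the three rotated copies is compared. The lists
    do not depend on K, so that the inequality can be integrated in K. *)
Lemma hex_comparison (R : realType) (p q r : R) (s : seq (int * int)) :
  0 <= p -> p <= q -> q <= r -> p * q + q * r + r * p = 3 / 4 -> uniq s ->
  exists t1 t2 t3 : seq (int * int), [/\ uniq t1, uniq t2, uniq t3 &
    forall K, 27 / 5 <= K ->
    3 * (\sum_(v <- s) profile K (hexnorm v)%:~R) <=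
    \sum_(v <- t1) profile K (qform p q r v) +
    (\sum_(v <- t2) profile K (qform p q r v) +
     \sum_(v <- t3) profile K (qform p q r v))].
Proof.
move=> p0 pq qr pqr us.
have far t : uniq t ->
    (forall K, 27 / 5 <= K -> 301 / 50 <= \sum_(v <- t) profile K (qform p q r v)) ->
    exists t1 t2 t3 : seq (int * int), [/\ uniq t1, uniq t2, uniq t3 &
    forall K, 27 / 5 <= K ->
    3 * (\sum_(v <- s) profile K (hexnorm v)%:~R) <=
    \sum_(v <- t1) profile K (qform p q r v) +
    (\sum_(v <- t2) profile K (qform p q r v) +
     \sum_(v <- t3) profile K (qform p q r v))].
  move=> ut ht; exists t, t, t; split=> // K K0.
  have := ht K K0; have := sum_hexnorm_le K us; have [] := sum_outer_le K0 us; lra.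
have pq0 : 0 < p + q by nra.
have [y1|/ltW y1] := leP (p + q) (61 / 100).
  have hy : 0 < p + q <= 61 / 100 by rewrite pq0 y1.
  have [[k [k0 k1 hk]]|[k1 hk]] := profile_multiple hy.
    apply: (far [:: (k%:Z, k%:Z); (- k%:Z, - k%:Z)]).
      rewrite /= andbT inE xpair_eqE; move: k0; clear; lia.
    move=> K K0; rewrite sum_profile_diag; have := profile_le K0 k1; lra.
  apply: (far ([:: (1%:Z, 1%:Z); (- 1%:Z, - 1%:Z)] ++
               [:: (2%:Z, 2%:Z); (- 2%:Z, - 2%:Z)])) => //.
  move=> K K0; rewrite big_cat /= !sum_profile_diag.
  have := profile_le K0 k1.
  have k1' : p + q <= 1 by lra.
  have := profile_le K0 k1'.
  rewrite expr1n mul1r -[2%:R]/(2 : R) -natrX -[(2 ^ 2)%N%:R]/(4 : R); lra.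
have q0 : 0 <= q by lra.
have r0 : 0 <= r by lra.
(* (p + q) (p + r) = p^2 + 3/4 and p <= (p + q) / 2 bound the second norm. *)
have y2 : p + r <= 139 / 100 by nra.
have [y3|/ltW y3] := leP (q + r) (139 / 100).
  have hpq : 61 / 100 <= p + q <= 139 / 100 by lra.
  have hpr : 61 / 100 <= p + r <= 139 / 100 by lra.
  have hqr : 61 / 100 <= q + r <= 139 / 100 by lra.
  pose t := hexshell ++ [seq v <- s | outer v].
  have ut : uniq t.
    rewrite cat_uniq filter_uniq// andbT; apply/andP; split => //.
    by apply/hasPn => v; rewrite mem_filter => /andP[/andP[]].
  exists t, [seq hexrot v | v <- t], [seq hexrot v | v <- [seq hexrot v | v <- t]].
  split=> [//|||K K0].
  - by rewrite (map_inj_uniq hexrot_inj).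
  - by rewrite !(map_inj_uniq hexrot_inj).
  apply: le_trans (sum_profile_near_hex K0 p0 q0 r0 pqr hpq hpr hqr us) _.
  rewrite !big_map !big_split /= -addrA le_eqVlt; apply/orP; left; apply/eqP.
  by congr (_ + (_ + _)); apply: eq_bigr => v _; rewrite !qform_hexrot.
apply: (far hexshell) => // K K0; rewrite sum_hexshell.
have hpq : 61 / 100 <= p + q <= 139 / 100 by lra.
have hpr : 61 / 100 <= p + r <= 139 / 100 by lra.
have h : q + r <= p + q + (p + r) by lra.
have hS : (p + q + (p + r) + (q + r)) ^+ 2 =
   3 + 2 * ((p + q) ^+ 2 + (p + r) ^+ 2 + (q + r) ^+ 2) by lra.
have := profile_large_third K0 hpq hpr y3 h hS; lra.
Qed.

(** * From fixed rates to differences of exponentials *)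

(** The summand of the energy at squared length h y, divided by h, for the
    rates A = pi alpha h and B = pi beta h. *)
Definition gain (R : realType) (A B y : R) : R :=
  y * (expR (- (A * y)) - expR (- (B * y))).

Lemma is_derive_sum_expR (R : realType) (X : seq R) (K : R) :
  is_derive K 1 (fun K => \sum_(x <- X) x * expR (- (K * x)))
    (- \sum_(x <- X) x ^+ 2 * expR (- (K * x))).
Proof.
elim: X => [|x X IH].
  rewrite big_nil oppr0 (_ : (fun _ => _) = cst 0); first exact: is_derive_cst.
  by apply/funext => k; rewrite big_nil.
rewrite (_ : (fun _ => _) =
   (fun K => x * expR (- (K * x))) + (fun K => \sum_(y <- X) y * expR (- (K * y)))); last first.
  by apply/funext => k; rewrite big_cons.
rewrite big_cons opprD; apply: is_deriveD.
have D1 : is_derive K 1 (fun K => - (K * x)) (- x).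
  rewrite (_ : (fun K => _) = (- x) *: (@id R)).
    by apply: is_derive_eq; rewrite /GRing.scale/= mulr1.
  by apply/funext => k; rewrite -[RHS]/(- x * k) mulNr mulrC.
have D2 : is_derive K 1 (fun K => expR (- (K * x))) (expR (- (K * x)) * - x).
  exact: is_derive1_comp.
rewrite (_ : (fun K => _) = x *: (fun K => expR (- (K * x)))) //.
by apply: is_derive_eq; rewrite /GRing.scale/=; ring.
Qed.

(** The derivative of gain A B y in B is y^2 e^(- B y) = e^(- B) profile B y,
    so a comparison of profiles at every rate integrates to one of gains. *)
Lemma gain_sum_le (R : realType) (X Z : seq R) (A B : R) : A <= B ->
  (forall K, A <= K ->
     \sum_(x <- X) profile K x <= \sum_(z <- Z) profile K z) ->
  \sum_(x <- X) gain A B x <= \sum_(z <- Z) gain A B z.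
Proof.
move=> AB h.
pose F (Y : seq R) (K : R) := \sum_(y <- Y) y * expR (- (K * y)).
pose dF (Y : seq R) (K : R) := - \sum_(y <- Y) y ^+ 2 * expR (- (K * y)).
have FE Y : \sum_(y <- Y) gain A B y = F Y A - F Y B.
  by rewrite /F -sumrB; apply: eq_bigr => y _; rewrite /gain mulrBr.
have DF Y (K : R) : is_derive K 1 (F Y) (dF Y K) by exact: is_derive_sum_expR.
have D (K : R) : is_derive K 1 (F X - F Z) (dF X K - dF Z K) by exact: is_deriveB.
have cF : {within `[A, B], continuous (F X - F Z)}.
  by apply: derivable_within_continuous => K _; apply: ex_derive.
have [c /itvP cAB cE] := @MVT_segment R _ _ A B AB (fun K _ => D K) cF.
have dFE Y K : dF Y K = - expR (- K) * \sum_(y <- Y) profile K y.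
  rewrite /dF mulNr mulr_sumr; congr (- _); apply: eq_bigr => y _.
  by rewrite /profile mulrCA -expRD; congr (_ * expR _); ring.
have dc : 0 <= dF X c - dF Z c.
  by rewrite !dFE !mulNr opprK addrC -mulrBr mulr_ge0 ?expR_ge0 ?subr_ge0 ?h ?cAB.
have : 0 <= (F X - F Z) B - (F X - F Z) A.
  by rewrite cE; apply: mulr_ge0; [exact: dc | rewrite subr_ge0].
rewrite !FE; set a := (F X - F Z) B; set b := (F X - F Z) A.
have -> : a = F X B - F Z B by [].
have -> : b = F X A - F Z A by [].
lra.
Qed.

(** One of the three lists does at least as well as their mean. *)
Lemma hex_gain_le (R : realType) (p q r A B : R) (s : seq (int * int)) :
  0 <= p -> p <= q -> q <= r -> p * q + q * r + r * p = 3 / 4 ->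
  27 / 5 <= A -> A <= B -> uniq s ->
  exists2 t, uniq t &
    \sum_(v <- s) gain A B (hexnorm v)%:~R <=
    \sum_(v <- t) gain A B (qform p q r v).
Proof.
move=> p0 pq qr pqr A0 AB us.
have [t1 [t2 [t3 [u1 u2 u3 h]]]] := hex_comparison p0 pq qr pqr us.
pose X := [seq (hexnorm v)%:~R : R | v <- s].
pose Z t := [seq qform p q r v | v <- t].
have : \sum_(x <- X ++ (X ++ X)) gain A B x <=
       \sum_(z <- Z t1 ++ (Z t2 ++ Z t3)) gain A B z.
  apply: gain_sum_le => // K AK; rewrite !big_cat /= !big_map.
  by have := h K (le_trans A0 AK); lra.
rewrite !big_cat /= !big_map => {}h.
have [le1|lt1] := leP (\sum_(v <- s) gain A B (hexnorm v)%:~R)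
                      (\sum_(v <- t1) gain A B (qform p q r v)); first by exists t1.
have [le2|lt2] := leP (\sum_(v <- s) gain A B (hexnorm v)%:~R)
                      (\sum_(v <- t2) gain A B (qform p q r v)); first by exists t2.
exists t3 => //; move: h lt1 lt2; clear; lra.
Qed.

(** * Selling reduction *)

Lemma exists_min_seq (R : realDomainType) (T : eqType) (F : T -> R) (s : seq T) (x0 : T) :
  x0 \in s -> exists2 x, x \in s & forall y, y \in s -> F x <= F y.
Proof.
elim: s x0 => // a s IH x0 _; case: s IH => [_|b s /(_ b)].
  by exists a; rewrite ?inE// => y; rewrite inE => /eqP ->.
rewrite inE eqxx => /(_ isT)[x xs xmin].
have [ax|/ltW xa] := leP (F a) (F x).
  exists a; rewrite ?inE ?eqxx// => y; rewrite inE => /predU1P[-> //|ys].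
  exact: le_trans ax (xmin _ ys).
by exists x; rewrite 1?inE ?xs ?orbT// => y; rewrite inE => /predU1P[-> //|/xmin].
Qed.

Definition bform (R : realType) (a b c : R) (u v : int * int) : R :=
  a * u.1%:~R * v.1%:~R + b * (u.1%:~R * v.2%:~R + u.2%:~R * v.1%:~R)
    + c * u.2%:~R * v.2%:~R.

Definition det2 (u v : int * int) : int := u.1 * v.2 - u.2 * v.1.

(** Completing the square: c (a m^2 + 2 b m n + c n^2) = m^2 + (b m + c n)^2
    since a c - b^2 = 1, and symmetrically. *)
Lemma bform_coercive (R : realType) (a b c : R) (u : int * int) :
  0 < a -> a * c - b ^+ 2 = 1 ->
  `|u.1|%N%:R <= c * bform a b c u u /\ `|u.2|%N%:R <= a * bform a b c u u.
Proof.
move=> a0 abc; case: u => m n; rewrite /bform /=.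
have sq (k : int) : `|k|%N%:R <= k%:~R ^+ 2 :> R.
  have : `|k|%N%:Z <= k ^+ 2.
    have kE : k ^+ 2 = `|k|%N%:Z ^+ 2.
      by rewrite abszE -normrX ger0_norm// sqr_ge0.
    by rewrite kE; case: `|k|%N => // l; rewrite expr2 ler_peMr.
  by rewrite -(ler_int R) rmorphXn.
have hm := sq m; have hn := sq n.
split.
  apply: le_trans hm _; have := sqr_ge0 (b * m%:~R + c * n%:~R).
  have : c * (a * m%:~R * m%:~R) = (1 + b ^+ 2) * m%:~R ^+ 2.
    by rewrite -abc; ring.
  lra.
apply: le_trans hn _; have := sqr_ge0 (a * m%:~R + b * n%:~R).
have : a * (c * n%:~R * n%:~R) = (1 + b ^+ 2) * n%:~R ^+ 2.
  by rewrite -abc; ring.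
lra.
Qed.

(** Choose a basis minimising N u + N v + N (u + v), where N is the quadratic
    form; the minimum exists because only finitely many vectors have bounded
    norm. If one of the three inequalities failed, replacing v by - v or by u +
    v, or u by u + v, would give a smaller sum. *)
Lemma selling_reduction (R : realType) (a b c : R) :
  0 < a -> a * c - b ^+ 2 = 1 ->
  exists u v : int * int, [/\ det2 u v ^+ 2 = 1, bform a b c u v <= 0,
    0 <= bform a b c u u + bform a b c u v &
    0 <= bform a b c v v + bform a b c u v].
Proof.
move=> a0 abc; pose N := fun u => bform a b c u u.
pose F (w : (int * int) * (int * int)) := N w.1 + N w.2 + bform a b c w.1 w.2.
have c0 : 0 < c by have := sqr_ge0 b; nra.
have N0 u : 0 <= N u.
  have [_ h] := bform_coercive u a0 abc.
  by rewrite -(pmulr_rge0 _ a0); exact: le_trans h.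
have FE w : F w = (N w.1 + N w.2 + N (w.1.1 + w.2.1, w.1.2 + w.2.2)) / 2.
  by rewrite /F /N /bform /= !rmorphD /=; field.
pose e : (int * int) * (int * int) := ((1, 0), (0, 1)).
have F0 w : 0 <= F w.
  by rewrite FE; apply: divr_ge0 => //; exact: addr_ge0 (addr_ge0 (N0 _) (N0 _)) (N0 _).
have [D DF] : exists D : nat, 2 * (a + c) * F e <= D%:R.
  exists (Num.bound (2 * (a + c) * F e)); apply/ltW/archi_boundP.
  by rewrite !mulr_ge0//; lra.
pose L : seq int := [seq i%:Z - D%:Z | i <- iota 0 (2 * D + 1)].
have LP m : (`|m| <= D)%N -> m \in L.
  move=> mD; apply/mapP; exists `|(m + D%:Z)%R|%N; last by lia.
  by rewrite mem_iota; lia.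
pose L2 := [seq (m, n) | m <- L, n <- L].
have L2P u : (`|u.1| <= D)%N -> (`|u.2| <= D)%N -> u \in L2.
  by case: u => m n /= hm hn; apply/allpairsP; exists (m, n); rewrite !LP.
pose cand := [seq w <- [seq (u, v) | u <- L2, v <- L2] | det2 w.1 w.2 ^+ 2 == 1].
have candP w : det2 w.1 w.2 ^+ 2 = 1 -> F w <= F e -> w \in cand.
  case: w => u v /= duv Fuv; rewrite mem_filter /= duv eqxx /=.
  have key x : N x <= 2 * F (u, v) -> x \in L2.
    move=> Nx; have [h1 h2] := bform_coercive x a0 abc.
    have h : (a + c) * N x <= D%:R.
      apply: le_trans DF; rewrite -mulrA mulrCA ler_wpM2l//; first lra.
      by apply: le_trans Nx _; rewrite ler_wpM2l.
    have := N0 x => Nx0.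
    by apply: L2P; rewrite -(ler_nat R); [apply: le_trans h1 _|apply: le_trans h2 _];
      rewrite -/(N x); nra.
  apply/allpairsP; exists (u, v); split=> //=; apply: key; rewrite FE /=;
    by have := N0 u; have := N0 v; have := N0 (u.1 + v.1, u.2 + v.2); lra.
have ecand : e \in cand by apply: candP.
have [[u v] wc wmin] := exists_min_seq F ecand.
have duv : det2 u v ^+ 2 = 1 by move: wc; rewrite mem_filter => /andP[/eqP].
have gmin w : det2 w.1 w.2 ^+ 2 = 1 -> F (u, v) <= F w.
  move=> dw; have [/candP h|/ltW] := leP (F w) (F e); first exact/wmin/h.
  by apply: le_trans; exact: wmin.
exists u, v; split=> //.
- have := gmin (u, (- v.1, - v.2)).
  rewrite /= (_ : det2 _ _ ^+ 2 = det2 u v ^+ 2); last by rewrite /det2 /=; ring.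
  move=> /(_ duv); rewrite /F /N /bform /= !rmorphN /=; lra.
- have := gmin (u, (v.1 + u.1, v.2 + u.2)).
  rewrite /= (_ : det2 _ _ ^+ 2 = det2 u v ^+ 2); last by rewrite /det2 /=; ring.
  move=> /(_ duv); rewrite /F /N /bform /= !rmorphD /=; lra.
- have := gmin ((u.1 + v.1, u.2 + v.2), v).
  rewrite /= (_ : det2 _ _ ^+ 2 = det2 u v ^+ 2); last by rewrite /det2 /=; ring.
  move=> /(_ duv); rewrite /F /N /bform /= !rmorphD /=; lra.
Qed.

(** Injectivity of psi is what it takes to bound a sum of nonnegative terms
    over the lattice below by a sum of values of the reduced form. *)
Definition represents (R : realType) (a b c p q r : R) : Prop :=
  exists2 psi : int * int -> int * int, injective psi &
    forall v, bform a b c (psi v) (psi v) = qform p q r v.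

Lemma represents_swap12 (R : realType) (a b c p q r : R) :
  represents a b c p q r -> represents a b c q p r.
Proof.
move=> [psi psi_inj h]; exists (fun v => psi (v.2, v.1)).
  by move=> [m n] [m' n'] /psi_inj[-> ->].
move=> v; rewrite h /qform /= -opprB rmorphN sqrrN; ring.
Qed.

Lemma represents_swap23 (R : realType) (a b c p q r : R) :
  represents a b c p q r -> represents a b c p r q.
Proof.
move=> [psi psi_inj h]; exists (fun v => psi (v.1, v.1 - v.2)).
  by move=> [m n] [m' n'] /psi_inj[-> /= e]; congr (_, _); lia.
by move=> v; rewrite h /qform /= subKr; ring.
Qed.

(** The Selling parameters of a reduced basis satisfy p q + q r + r p = N u N v
    - B^2 = (a c - b^2) det^2 = 1; they are then sorted by exchanging the three
    vectors of the superbase. *)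
Lemma reduced_form (R : realType) (a b c : R) : 0 < a -> a * c - b ^+ 2 = 1 ->
  exists p q r, [/\ 0 <= p <= q, q <= r, p * q + q * r + r * p = 1 &
    represents a b c p q r].
Proof.
move=> a0 abc; have [u [v [duv B0 uB vB]]] := selling_reduction a0 abc.
pose B := bform a b c u v.
pose p := bform a b c u u + B; pose q := bform a b c v v + B; pose r := - B.
have p0 : 0 <= p by [].
have q0 : 0 <= q by [].
have r0 : 0 <= r by rewrite oppr_ge0.
have pqr : p * q + q * r + r * p = 1.
  have duvR : (u.1%:~R * v.2%:~R - u.2%:~R * v.1%:~R) ^+ 2 = 1 :> R.
    have : (det2 u v ^+ 2)%:~R = 1 :> R by rewrite duv.
    by rewrite /det2 rmorphXn rmorphB !rmorphM.
  transitivity ((a * c - b ^+ 2) * (u.1%:~R * v.2%:~R - u.2%:~R * v.1%:~R) ^+ 2).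
    by rewrite /p /q /r /B /bform; ring.
  by rewrite abc duvR mulr1.
have rep : represents a b c p q r.
  exists (fun w => (w.1 * u.1 + w.2 * v.1, w.1 * u.2 + w.2 * v.2)).
    move=> [m n] [m' n'] /= [e1 e2].
    have d0 : det2 u v != 0 by apply/eqP => d; rewrite d in duv.
    have h1 : m * det2 u v = m' * det2 u v.
      have -> : m * det2 u v = (m * u.1 + n * v.1) * v.2 - (m * u.2 + n * v.2) * v.1.
        by rewrite /det2; ring.
      by rewrite e1 e2 /det2; ring.
    have h2 : n * det2 u v = n' * det2 u v.
      have -> : n * det2 u v = (m * u.2 + n * v.2) * u.1 - (m * u.1 + n * v.1) * u.2.
        by rewrite /det2; ring.
      by rewrite e1 e2 /det2; ring.
    by rewrite (mulIf d0 h1) (mulIf d0 h2).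
  move=> w; rewrite /p /q /r /B /qform /bform /=.
  by rewrite !rmorphD !rmorphM rmorphN /=; ring.
clearbody p q r; clear B B0 uB vB.
have sorted12 p' q' r' : 0 <= p' -> p' <= q' -> 0 <= r' ->
    p' * q' + q' * r' + r' * p' = 1 -> represents a b c p' q' r' ->
    exists p q r, [/\ 0 <= p <= q, q <= r, p * q + q * r + r * p = 1 &
      represents a b c p q r].
  move=> p'0 pq' r'0 pqr' rep'.
  have [qr|/ltW rq] := leP q' r'.
    by exists p', q', r'; split=> //; rewrite p'0 pq'.
  have [pr|/ltW rp] := leP p' r'.
    exists p', r', q'; split=> //; first by rewrite p'0 pr.
    - by rewrite -pqr'; ring.
    - exact: represents_swap23.
  exists r', p', q'; split=> //; first by rewrite r'0 rp.
  - by rewrite -pqr'; ring.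
  - exact/represents_swap12/represents_swap23.
have [pq|/ltW qp] := leP p q; first exact: (sorted12 p q r).
apply: (sorted12 q p r) => //; first by rewrite -pqr; ring.
exact: represents_swap12.
Qed.

(** * The angle pi / 3 and a lower bound for pi *)

Lemma sin_le_id (R : realType) (x : R) : 0 <= x -> sin x <= x.
Proof.
move=> x0; rewrite -subr_ge0; move: x x0.
apply: (@ge0_from_derive _ _ (fun x => 1 - cos x)).
- by rewrite sin0 subr0.
- by move=> x _; rewrite subr_ge0 cos_le1.
Qed.

Lemma cos_double (R : realType) (x : R) : cos (2 * x) = 2 * cos x ^+ 2 - 1.
Proof. by rewrite mulrC mulr_natr cos_mulr2n mulr2n; ring. Qed.

(** From cos (3 x) = - 1 at x = pi / 3: the cubic factors as (C + 1) (2 C -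
    1)^2 = 0, and C > 0. *)
Lemma cos_pi3 (R : realType) : cos (pi / 3) = 2^-1 :> R.
Proof.
set x : R := pi / 3.
have c0 : 0 < cos x.
  by have := pi_gt0 R => p0; apply: cos_gt0_pihalf; rewrite /x; lra.
have : cos (2 * x + x) = -1.
  by rewrite (_ : _ + _ = pi) ?cospi// /x; field.
rewrite cosD cos_double mulrC [2 * x]mulrC mulr_natr sin_mulr2n -[(_ * _) *+ 2]mulr_natr.
have s2 := sin2cos2 x; move: s2 c0; move: (cos x) (sin x) => C S s2 c0 h.
have : (C + 1) * (2 * C - 1) ^+ 2 = 0.
  have -> : (C + 1) * (2 * C - 1) ^+ 2 =
    (C * (2 * C ^+ 2 - 1) - C * S * 2 * S) + 1 + 2 * C * (S ^+ 2 - (1 - C ^+ 2)).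
    by ring.
  by rewrite h s2; ring.
move=> /eqP; rewrite mulf_eq0 sqrf_eq0 => /orP[/eqP e|/eqP e].
  by exfalso; lra.
by lra.
Qed.

Lemma sin_pi3_sqr (R : realType) : sin (pi / 3) ^+ 2 = 3 / 4 :> R.
Proof. by rewrite sin2cos2 cos_pi3; field. Qed.

Lemma sin_pi3_gt0 (R : realType) : 0 < sin (pi / 3) :> R.
Proof. by have := pi_gt0 R => p0; apply: sin_gt0_pi; lra. Qed.

(** The estimate pi >= 24 sin (pi / 24), with the sine bounded below by halving
    the angle pi / 3 three times; its true value is about 3.1326. *)
Lemma pi_ge (R : realType) : 78 / 25 <= pi :> R.
Proof.
have p0 := pi_gt0 R.
pose x : R := pi / 24.
have c6 : cos (2 * (2 * x)) ^+ 2 = 3 / 4.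
  have := cos_double (2 * (2 * x)).
  by rewrite (_ : 2 * (2 * (2 * x)) = pi / 3) ?cos_pi3; [lra | rewrite /x; field].
have c6' : cos (2 * (2 * x)) <= 867 / 1000.
  rewrite leNgt; apply/negP => lt; nra.
have c12 : cos (2 * x) <= 4831 / 5000.
  have := cos_double (2 * x) => h.
  rewrite leNgt; apply/negP => lt; nra.
have sx : 13 / 100 <= sin x.
  have s0 : 0 <= sin x by apply: sin_ge0_pi; rewrite /x; lra.
  have := cos_double x; have := sin2cos2 x => h1 h2.
  rewrite leNgt; apply/negP => lt; nra.
have : sin x <= x by apply: sin_le_id; rewrite /x; lra.
rewrite {2}/x; lra.
Qed.

(** * Energies as sums over pairs of integers *)

Lemma le_esumT (R : realType) (T : choiceType) (F : T -> R) (t : seq T) :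
  uniq t -> ((\sum_(v <- t) F v)%:E <= \esum_(v in [set: T]) (F v)%:E)%E.
Proof.
move=> ut; apply: esum_ge; exists [set` t]; first by split.
by rewrite -fsbig_seq// sumEFin.
Qed.

Lemma esumT_le (R : realType) (T : choiceType) (F : T -> R) (M : \bar R) :
  (forall s : seq T, uniq s -> ((\sum_(v <- s) F v)%:E <= M)%E) ->
  (\esum_(v in [set: T]) (F v)%:E <= M)%E.
Proof.
move=> h; apply: ge_ereal_sup => _ [X [finX _] <-].
by rewrite fsbig_finite// sumEFin; apply: h; exact: finmap.fset_uniq.
Qed.

Definition lattice_point (R : realType) (z : R[i]) (v : int * int) : R[i] :=
  ((Num.sqrt (complex.Im z))^-1)%:C%C * (v.1%:~R + v.2%:~R * z).

(** The form |m + n z|^2 / Im z has determinant 1, which is the statement that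
    the lattice has unit density. *)
Lemma normc_lattice_point (R : realType) (z : R[i]) (v : int * int) :
  0 < complex.Im z ->
  Normc.normc (lattice_point z v) ^+ 2 =
  bform (complex.Im z)^-1 (complex.Re z / complex.Im z)
    ((complex.Re z ^+ 2 + complex.Im z ^+ 2) / complex.Im z) v v.
Proof.
case: z => x y /= y0; case: v => m n.
set k := (Num.sqrt y)^-1.
have k2 : k ^+ 2 = y^-1 by rewrite /k exprVn sqr_sqrtr// ltW.
have -> : lattice_point (x +i* y)%C (m, n) =
    ((k * (m%:~R + n%:~R * x)) +i* (k * (n%:~R * y)))%C.
  by rewrite /lattice_point /= -!(rmorph_int (@real_complex R)); simpc.
rewrite /Normc.normc.
rewrite sqr_sqrtr ?addr_ge0 ?sqr_ge0// !exprMn k2 /bform /=.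
by field; rewrite gt_eqF.
Qed.

Lemma lattice_form_det (R : realType) (x y : R) : 0 < y ->
  y^-1 * ((x ^+ 2 + y ^+ 2) / y) - (x / y) ^+ 2 = 1.
Proof. by move=> y0; field; rewrite gt_eqF. Qed.

Lemma lattice_point_inj (R : realType) (z : R[i]) : 0 < complex.Im z ->
  injective (lattice_point z).
Proof.
move=> y0 u v uv; pose w := (u.1 - v.1, u.2 - v.2).
have w0 : lattice_point z w = 0.
  have -> : lattice_point z w = lattice_point z u - lattice_point z v.
    by rewrite /lattice_point /w /= !rmorphB /=; ring.
  by rewrite uv subrr.
have := normc_lattice_point w y0; rewrite w0 Normc.normc0 expr0n /= => B0.
have a0 : 0 < (complex.Im z)^-1 by rewrite invr_gt0.
have [] := bform_coercive w a0 (lattice_form_det (complex.Re z) y0).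
rewrite -B0 !mulr0 !lern0 !absz_eq0 !subr_eq0 => /eqP e1 /eqP e2.
by case: u v e1 e2 {uv w w0 B0} => [a b] [c d] /= -> ->.
Qed.

(** The factor h rescales the norms, so that Y can be a normalised form. *)
Lemma energy_unit_lattice (R : realType) (alpha beta h : R) (z : R[i])
    (Y : int * int -> R) : 0 < complex.Im z -> h != 0 ->
  (forall v, bform (complex.Im z)^-1 (complex.Re z / complex.Im z)
    ((complex.Re z ^+ 2 + complex.Im z ^+ 2) / complex.Im z) v v = h * Y v) ->
  energy alpha beta (unit_lattice z) =
  (\esum_(v in [set: int * int])
    (h * gain (pi * alpha * h) (pi * beta * h) (Y v))%:E)%E.
Proof.
move=> y0 h0 hY; rewrite /energy.
have -> : unit_lattice z = lattice_point z @` [set: int * int].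
  apply/seteqP; split => P /=.
    by move=> [m [n ->]]; exists (m, n).
  by move=> [[m n] _ <-]; exists m, n.
rewrite esum_image; last by move=> u v _ _; exact: lattice_point_inj.
apply: eq_esum => v _; congr (_%:E).
rewrite normc_lattice_point// hY /gain; rewrite [RHS]mulrA.
by congr (_ * (expR _ - expR _)); ring.
Qed.

(** * Optimality of the hexagonal lattice *)

(** The one place where alpha >= 3/2 matters: pi * 3/2 * 2 / sqrt 3 = sqrt 3 *
    pi is about 5.44, just above the value 27/5 used for all numerical bounds. *)
Lemma rate_ge (R : realType) (alpha : R) : 3 / 2 <= alpha ->
  27 / 5 <= pi * alpha * (sin (pi / 3))^-1.
Proof.
move=> ha; have s0 := sin_pi3_gt0 R; have s2 := sin_pi3_sqr R.
have pi3 := pi_ge R.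
have s1 : sin (pi / 3) <= 433 / 500 + 1 / 10000 :> R.
  rewrite leNgt; apply/negP => lt; nra.
rewrite ler_pdivlMr//; nra.
Qed.

Theorem corollary1p1 (R : realType) (alpha beta : R)
    (halpha : 3 / 2 <= alpha) (hbeta : alpha < beta) :
  unit_lattices R (hexagonal_lattice R) /\
  (forall L : set (complex R), unit_lattices R L ->
     (energy alpha beta (hexagonal_lattice R) <= energy alpha beta L)%E).
Proof.
have s0 := sin_pi3_gt0 R; have s2 := sin_pi3_sqr R.
split; first by exists (expi (pi / 3)).
move=> _ [z /= y0 <-].
set h : R := (sin (pi / 3))^-1.
have h0 : 0 < h by rewrite invr_gt0.
have hn0 : h != 0 by rewrite gt_eqF.
have h2 : h ^+ 2 = 4 / 3 by rewrite exprVn s2; field.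
have a0 : 0 < (complex.Im z)^-1 by rewrite invr_gt0.
have [p [q [r [/andP[p0 pq] qr pqr [psi psi_inj psiE]]]]] :=
  reduced_form a0 (lattice_form_det (complex.Re z) y0).
have A0 := rate_ge halpha.
have AB : pi * alpha * h <= pi * beta * h.
  by rewrite ler_wpM2r ?(ltW h0)// ler_wpM2l ?pi_ge0// ltW.
rewrite /hexagonal_lattice.
rewrite (@energy_unit_lattice _ alpha beta h (expi (pi / 3))
  (fun v => (hexnorm (v.1, - v.2))%:~R))//; last first.
  move=> v; rewrite /bform /expi /= cos_pi3 s2 -/h hexnormE /qform /=.
  by rewrite !(rmorphN, rmorphB) /=; field.
rewrite (@energy_unit_lattice _ alpha beta h z (fun v => h^-1 *
  bform (complex.Im z)^-1 (complex.Re z / complex.Im z)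
    ((complex.Re z ^+ 2 + complex.Im z ^+ 2) / complex.Im z) v v))//; last first.
  by move=> v; rewrite mulrA divff// mul1r.
apply: esumT_le => s us.
have us' : uniq [seq (v.1, - v.2) | v <- s].
  rewrite map_inj_uniq// => -[m n] [m' n'] [-> /oppr_inj ->] //.
have hV : 0 < h^-1 by rewrite invr_gt0.
have PQR : h^-1 * p * (h^-1 * q) + h^-1 * q * (h^-1 * r) + h^-1 * r * (h^-1 * p)
    = 3 / 4.
  transitivity ((h ^+ 2)^-1 * (p * q + q * r + r * p)); first by field.
  by rewrite h2 pqr; field.
have [||| t ut le_st] := hex_gain_le (p := h^-1 * p) (q := h^-1 * q)
  (r := h^-1 * r) _ _ _ PQR A0 AB us'.
- by rewrite mulr_ge0// ltW.
- by rewrite ler_pM2l.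
- by rewrite ler_pM2l.
have ut' : uniq [seq psi v | v <- t] by rewrite map_inj_uniq.
apply: le_trans (le_esumT _ ut').
rewrite lee_fin big_map -!mulr_sumr ler_pM2l//.
move: le_st; rewrite big_map => /le_trans; apply.
rewrite le_eqVlt; apply/orP; left; apply/eqP; apply: eq_bigr => v _.
by rewrite psiE; congr gain; rewrite /qform; ring.
Qed.
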